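(* Let $\alpha,\beta,\gamma,t$ be integers with $1\le\alpha\le\beta$, $\gamma=2(\alpha+\beta)$, and $t\ge\frac13(\alpha+\beta+\gamma)=\alpha+\beta$. Set $\delta=t-(\alpha+\beta)$. Then the matrix $M=M(\alpha,\beta,\gamma,t)$ is the $\delta\times\delta$ matrix with entry $(i,j)$ given by $$M_{(i,j)}=\binom{\gamma}{\alpha+\beta+i-j}\qquad(1\le i,j\le\delta),$$ and its determinant is $$\det M=\frac{\mathcal H(\delta)\,\mathcal H(\alpha+\beta)^2\,\mathcal H(\gamma+\delta)}{\mathcal H(\gamma)\,\mathcal H(t)^2}.$$
   Context: For an integer $n\ge0$, the hyperfactorial is $\mathcal H(n)=\prod_{i=0}^{n-1} i!$, with $\mathcal H(0)=1$. Binomial coefficients $\binom{a}{b}$ with $a\ge 0$ are $0$ if $b<0$ or $b>a$. The determinant of the empty ($0\times0$) matrix is $1$. For integers $1\le\alpha\le\beta\le\gamma\le 2(\alpha+\beta)$ with $3\mid\alpha+\beta+\gamma$ and $t\ge\frac13(\alpha+\beta+\gamma)$, let $M=M(\alpha,\beta,\gamma,t)$ be the square integer matrix of size $n=t+\frac13(\alpha+\beta-2\gamma)$ defined as follows. Its first $m=t-\frac13(\alpha+\beta+\gamma)$ rows have entries $$M_{(i,j)}=\binom{\gamma}{\frac13(\alpha+\beta+\gamma)+i-j}\quad(1\le i\le m,\ 1\le j\le n),$$ and its last $\frac13(2(\alpha+\beta)-\gamma)$ rows have entries $$M_{(m+k,j)}=\binom{\gamma+t}{t+\beta+1-k-j}\quad(1\le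 k\le\tfrac13(2(\alpha+\beta)-\gamma),\ 1\le j\le n).$$ *)

(* Defs.v *)
From mathcomp Require Import all_boot all_order all_algebra.

Set Implicit Arguments.
Unset Strict Implicit.
Unset Printing Implicit Defensive.

Import GRing.Theory.
Local Open Scope ring_scope.

Definition hyperfactorial (n : nat) : nat := (\prod_(0 <= i < n) i`!)%N.

(* Binomial coefficient with an integer lower index: zero when b < 0 (and,
   by the convention for 'C(a, b), also when b > a). *)
Definition binz (a : nat) (b : int) : int :=
  match b with
  | Posz k => 'C(a, k)%:Z
  | Negz _ => 0
  end.

(* All divisions by 3 are exact and all subtractions on nat are untruncated
   when 3 %| alpha + beta + gamma, gamma <= 2 * (alpha + beta) and
   alpha + beta + gamma <= 3 * t.  The size t + (alpha + beta - 2 gamma) / 3 is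
   put over a common denominator, since alpha + beta - 2 gamma may be
   negative. *)
Definition Msize (alpha beta gamma t : nat) : nat :=
  ((3 * t + (alpha + beta) - 2 * gamma) %/ 3)%N.

Definition Mtop (alpha beta gamma t : nat) : nat :=
  (t - (alpha + beta + gamma) %/ 3)%N.

(* Ordinals start at 0, so i.+1 and j.+1 are the 1-based indices; in the lower
   block the row m + k has k = i.+1 - m. *)
Definition Mmat (alpha beta gamma t : nat) :
    'M[int]_(Msize alpha beta gamma t) :=
  \matrix_(i, j)
    let m := Mtop alpha beta gamma t in
    if (i < m)%N then
      binz gamma (((alpha + beta + gamma) %/ 3)%N%:Z + i.+1%:Z - j.+1%:Z)
    else
      let k := (i.+1 - m)%N in
      binz (gamma + t) (t%:Z + beta%:Z + 1 - k%:Z - j.+1%:Z).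

(* Main.v *)
Require Import Defs.
From mathcomp Require Import all_boot all_order all_algebra.
From mathcomp Require Import zify ring.

(** Let U be the upper unitriangular matrix with entries 'C(j, k).  By
    Vandermonde's convolution the Toeplitz matrix T of the 'C(a + b, a + i - j)
    satisfies (T U)_(i,j) = 'C(a + b + j, a + i), which up to factorials
    depending on i or on j alone is 'C(b + j, i).  By the same convolution the
    latter matrix factors as L U with L lower unitriangular, so it has
    determinant 1 and only the factorials contribute to det T. *)

Set Implicit Arguments.
Unset Strict Implicit.
Unset Printing Implicit Defensive.

Import GRing.Theory.
Local Open Scope ring_scope.

Lemma binzE (a p k : nat) :
  binz a (p%:Z - k%:Z) = if (k <= p)%N then 'C(a, p - k)%:Z else 0.
Proof.
case: leqP => hkp; first by rewrite subzn.
by case E: (p%:Z - k%:Z) => [q|q] //=; lia.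
Qed.

(** Vandermonde's convolution in the form of a matrix product entry: the sum stops at the matrix
    size [n] instead of at [p]. The bound [j < n] ensures that no nonzero term is cut off. *)
Lemma Vandermonde_binz (n a p j : nat) : (j < n)%N ->
  \sum_(k < n) binz a (p%:Z - k%:Z) * 'C(j, k)%:Z = 'C(a + j, p)%:Z.
Proof.
move=> hj; set F := fun k : nat => binz a (p%:Z - k%:Z) * 'C(j, k)%:Z.
have widen m q : (m <= q)%N -> (forall k, (m <= k)%N -> F k = 0) ->
    \sum_(k < m) F k = \sum_(k < q) F k.
  move=> le_mq F0; rewrite (big_ord_widen _ F le_mq).
  rewrite [RHS](bigID (fun k : 'I_q => (k < m)%N)) /=.
  by rewrite [X in _ + X]big1 ?addr0 // => k; rewrite -leqNgt; apply: F0.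
(* The ranges [n] and [p.+1] are compared through their maximum: terms with [n <= k] vanish since
   ['C(j, k) = 0], terms with [p < k] since the lower index [p - k] is negative. *)
rewrite (@widen n (maxn n p.+1)) ?leq_maxl //; last first.
  by move=> k hk; rewrite /F bin_small ?mulr0 //; apply: leq_trans hk.
rewrite -(@widen p.+1) ?leq_maxr //; last first.
  by move=> k hk; rewrite /F binzE leqNgt hk mul0r.
rewrite addnC -binomial.Vandermonde -natz natr_sum; apply: eq_bigr => k _.
by rewrite /F binzE -ltnS ltn_ord natrM !natz mulrC.
Qed.

Definition binomial_mx (n : nat) : 'M[int]_n := \matrix_(k, j) 'C(j, k)%:Z.

Lemma det_binomial_mx (n : nat) : \det (binomial_mx n) = 1.
Proof.
rewrite -det_tr det_trig; last first.
  by apply/is_trig_mxP => i j hij; rewrite !mxE bin_small.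
by rewrite big1 // => i _; rewrite !mxE binn.
Qed.

Lemma det_binomial_shift (n b : nat) :
  \det (\matrix_(i < n, j < n) 'C(b + j, i)%:Z) = 1.
Proof.
pose L : 'M[int]_n := \matrix_(i, k) binz b (i%:Z - k%:Z).
have -> : \matrix_(i, j) 'C(b + j, i)%:Z = L *m binomial_mx n.
  apply/matrixP => i j; rewrite !mxE -(Vandermonde_binz b i (ltn_ord j)).
  by apply: eq_bigr => k _; rewrite !mxE.
rewrite det_mulmx det_binomial_mx mulr1 det_trig; last first.
  by apply/is_trig_mxP => i j hij; rewrite mxE binzE leqNgt hij.
by rewrite big1 // => i _; rewrite mxE subrr /= bin0.
Qed.

(** Both binomials have the same complementary index [b + j - i], so for [i <= b + j] each side
    equals [(b + j)! (a + b + j)! / (b + j - i)!]; otherwise both sides vanish. The multiplicative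
    form avoids division in [nat]. *)
Lemma bin_shift_fact (a b i j : nat) :
  ((a + i)`! * (b + j)`! * 'C(a + b + j, a + i)
   = i`! * (a + b + j)`! * 'C(b + j, i))%N.
Proof.
have [lt_ji | le_ij] := ltnP (b + j) i.
  by rewrite !bin_small ?muln0 //; lia.
have le2 : (a + i <= a + b + j)%N by lia.
rewrite -(bin_fact le_ij) -(bin_fact le2).
have -> : (a + b + j - (a + i) = b + j - i)%N by lia.
by ring.
Qed.

(** The row factors [(a + i)!] and column factors [(b + j)!] stay on the left, which keeps the
    identity in [int]. *)
Lemma det_toeplitz_bin (n a b : nat) :
  (\prod_(i < n) (a + i)`!%:Z) * (\prod_(j < n) (b + j)`!%:Z)
    * \det (\matrix_(i < n, j < n) binz (a + b) ((a + i)%N%:Z - j%:Z))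
  = (\prod_(i < n) i`!%:Z) * \prod_(j < n) (a + b + j)`!%:Z.
Proof.
set T := \matrix_(i, j) _.
pose D (f : nat -> nat) : 'M[int]_n := diag_mx (\row_i (f i)%:Z).
have detD f : \det (D f) = \prod_(i < n) (f i)%:Z.
  by rewrite det_diag; apply: eq_bigr => i _; rewrite mxE.
have TU : T *m binomial_mx n = \matrix_(i, j) 'C(a + b + j, a + i)%:Z.
  apply/matrixP => i j; rewrite !mxE -(Vandermonde_binz _ _ (ltn_ord j)).
  by apply: eq_bigr => k _; rewrite !mxE.
(* Left and right multiplication by diagonal matrices scales rows and columns, so this is
   [bin_shift_fact] read entry by entry. *)
have eqM : D (fun i => (a + i)`!) *m (T *m binomial_mx n)
             *m D (fun j => (b + j)`!)
  = D factorial *m (\matrix_(i, j) 'C(b + j, i)%:Z)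
      *m D (fun j => (a + b + j)`!).
  rewrite TU /D; apply/matrixP => i j.
  rewrite !mul_mx_diag !mul_diag_mx !mxE -!PoszM; congr Posz.
  by rewrite mulnAC bin_shift_fact mulnAC.
move/(congr1 determinant): eqM.
rewrite !det_mulmx !detD det_binomial_mx det_binomial_shift !mulr1 => <-.
by rewrite mulrAC.
Qed.

Lemma hyperfactorial_add (a n : nat) :
  hyperfactorial (a + n) = (hyperfactorial a * \prod_(i < n) (a + i)`!)%N.
Proof.
rewrite /hyperfactorial (big_cat_nat (leq0n a) (leq_addr n a)) /=; congr muln.
by rewrite -{1}[a]add0n big_addn addKn big_mkord; under eq_bigr do rewrite addnC.
Qed.

Lemma hyperfactorial_neq0 (n : nat) : (hyperfactorial n)%:R != 0 :> rat.
Proof.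
rewrite Num.Theory.pnatr_eq0 -lt0n /hyperfactorial prodn_gt0 // => i.
exact: fact_gt0.
Qed.

(** Over [rat] each product of the [(c + i)!] becomes a quotient of hyperfactorials, and the integer
    identity can be solved for the determinant. *)
Lemma det_toeplitz_bin_hyperfactorial (n a b : nat) :
  (\det (\matrix_(i < n, j < n) binz (a + b) ((a + i)%N%:Z - j%:Z)))%:~R
  = (hyperfactorial n)%:R * (hyperfactorial a)%:R * (hyperfactorial b)%:R
      * (hyperfactorial (a + b + n))%:R
    / ((hyperfactorial (a + b))%:R * (hyperfactorial (a + n))%:R
      * (hyperfactorial (b + n))%:R) :> rat.
Proof.
have prodE c : (\prod_(i < n) (c + i)`!%:Z)%:~R
    = (hyperfactorial (c + n))%:R / (hyperfactorial c)%:R :> rat.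
  rewrite hyperfactorial_add natrM mulrAC mulfV ?hyperfactorial_neq0 // mul1r.
  by rewrite natr_prod rmorph_prod.
have prod0E : (\prod_(i < n) i`!%:Z)%:~R = (hyperfactorial n)%:R :> rat.
  by rewrite /hyperfactorial big_mkord natr_prod rmorph_prod.
have := congr1 (intr : int -> rat) (det_toeplitz_bin n a b).
rewrite !intrM !prodE prod0E; set d := (\det _)%:~R => eq_d.
have nz := hyperfactorial_neq0.
(* The last factor reproduces the left side of [eq_d]; the first one is the inverse of its
   coefficient of [d]. *)
have -> : d = (hyperfactorial a)%:R * (hyperfactorial b)%:R
    / ((hyperfactorial (a + n))%:R * (hyperfactorial (b + n))%:R)
    * ((hyperfactorial (a + n))%:R / (hyperfactorial a)%:R
       * ((hyperfactorial (b + n))%:R / (hyperfactorial b)%:R) * d).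
  by field; rewrite !nz.
by rewrite eq_d; field; rewrite !nz.
Qed.

Theorem theorem4p3 (alpha beta gamma t delta : nat)
    (halpha : (1 <= alpha)%N) (hbeta : (alpha <= beta)%N)
    (hgamma : gamma = (2 * (alpha + beta))%N)
    (ht : ((alpha + beta + gamma) %/ 3 <= t)%N)
    (hdelta : delta = (t - (alpha + beta))%N) :
  (exists e : Msize alpha beta gamma t = delta,
     castmx (e, e) (Mmat alpha beta gamma t)
     = \matrix_(i < delta, j < delta)
         binz gamma ((alpha + beta)%N%:Z + i.+1%:Z - j.+1%:Z))
  /\ (\det (Mmat alpha beta gamma t))%:~R
     = (hyperfactorial delta)%:R * (hyperfactorial (alpha + beta))%:R ^+ 2
         * (hyperfactorial (gamma + delta))%:R
       / ((hyperfactorial gamma)%:R * (hyperfactorial t)%:R ^+ 2) :> rat.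
Proof.
(* Since [gamma = 2 * (alpha + beta)], the sum is [3 * (alpha + beta)]. Hence [Mtop] and [Msize]
   both equal [delta], and the lower block of the matrix is empty. *)
have third : ((alpha + beta + gamma) %/ 3 = alpha + beta)%N by lia.
have e : Msize alpha beta gamma t = delta by rewrite /Msize; lia.
have eqM : castmx (e, e) (Mmat alpha beta gamma t)
    = \matrix_(i < delta, j < delta)
        binz gamma ((alpha + beta)%N%:Z + i.+1%:Z - j.+1%:Z).
  apply/matrixP => i j; rewrite castmxE !mxE /= /Mtop third.
  by rewrite -hdelta ltn_ord.
split; first by exists e.
have -> : \det (Mmat alpha beta gamma t)
    = \det (castmx (e, e) (Mmat alpha beta gamma t)) by case: _ / e {eqM}.
set s := (alpha + beta)%N in hgamma ht hdelta third eqM *.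
(* The shifts from 1-based indexing cancel, leaving the Toeplitz matrix with [a = b = s]. *)
have -> : castmx (e, e) (Mmat alpha beta gamma t)
    = \matrix_(i, j) binz (s + s) ((s + i)%N%:Z - j%:Z).
  rewrite eqM; apply/matrixP => i j; rewrite !mxE; congr binz; lia.
rewrite det_toeplitz_bin_hyperfactorial.
(* The subtraction defining [delta] is not truncated: [ht] and [third] give [s <= t]. *)
have -> : (s + delta = t)%N by lia.
have -> : (s + s = gamma)%N by lia.
by rewrite !expr2 !mulrA.
Qed.
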